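(* Let $\Gamma$ be a finite connected graph consisting of finitely many type $A$ chains (branches) and finitely many loops, all attached to a single vertex $i_0$ (equivalently, all cycles of $\Gamma$ are generated by loops, and every vertex other than $i_0$ has degree at most $2$). Fix an orientation $\Omega$ of $\Gamma$ and vector spaces $V_i$ at the vertices, with dimension vector $v$. Let $A=\{h\in H\mid in(h)=i_0,\ out(h)\ne i_0\}$ and $L=\{h\in\Omega\mid in(h)=out(h)=i_0\}$. For $B\in M_{\Gamma,v}$ and $h\in A$ put $N_h=\omega(h)B_{\overline h}B_h\in\mathrm{End}(V_{i_0})$. Then $B\in\mu^{-1}(0)$ is nilpotent if and only if the set of operators $\{N_h\mid h\in A\}\cup\{B_h\mid h\in L\cup\overline L\}\subset\mathrm{End}(V_{i_0})$ is nilpotent.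
   Context: All vector spaces are finite-dimensional over a fixed ground field. For a finite graph $\Gamma$ with vertex set $I$, $H$ is the set of edges together with a choice of direction on them (each edge, including each loop, gives two distinct elements $h,\overline h\in H$, where the bar denotes the reversed direction). For $h\in H$, $in(h)$ and $out(h)$ denote its source and target. An orientation is a subset $\Omega\subset H$ with $\Omega\cap\overline\Omega=\emptyset$, $\Omega\cup\overline\Omega=H$; the corresponding function $\omega:H\to\{\pm1\}$ is $1$ on $\Omega$ and $-1$ on $\overline\Omega$. For $v\in\mathbb Z_{\ge0}^I$ fix vector spaces $V_i$ with $\dim V_i=v_i$ and put $M_{\Gamma,v}=\bigoplus_{h\in H}\mathrm{Hom}(V_{in(h)},V_{out(h)})$, with elements $B=(B_h)_{h\in H}$. The moment map $\mu:M_{\Gamma,v}\to\bigoplus_{i\in I}\mathfrak{gl}(V_i)$ is $\mu(B)_i=\sum_{h\in H:\,in(h)=i}\omega(h)B_{\overline h}B_h$. An element $B\in M_{\Gamma,v}$ is nilpotent if there is $N\in\mathbb N$ such that for every $k>N$ and every path $g_1,\dots,g_k\in H$ with $out(g_j)=in(g_{j+1})$, one has $B_{g_k}\cdots B_{g_1}=0$. A set of operators $X_j\in\mathrm{End}(V)$, $j\in J$, is nilpotent if there is $N\in\mathbb N$ such that for every $k>N$ any composition of $k$ operators from the set (repetitions allowed) is $0$. *)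

(* Defs.v *)
From HB Require Import structures.
From mathcomp Require Import all_boot all_order all_algebra.

Set Implicit Arguments.
Unset Strict Implicit.
Unset Printing Implicit Defensive.

Import GRing.Theory.
Local Open Scope ring_scope.

(* A finite graph, given by its directed edges: [arrow i j] is the fibre over
   (i, j) of the map (in, out) : H -> I * I, so H is the disjoint union of all
   the [arrow i j].  Indexing by the endpoints lets operators compose without
   casts.  An edge joining i to j is a pair {h, rev h}; fixed points of [rev]
   can only occur on loops, where [rev_neq] excludes them. *)
Record graph := Graph {
  vertex :> finType;
  arrow : vertex -> vertex -> finType;
  rev : forall i j : vertex, arrow i j -> arrow j i;
  revK : forall (i j : vertex) (h : arrow i j), rev (rev h) = h;
  rev_neq : forall (i : vertex) (h : arrow i i), rev h != h
}.

Arguments rev {g i j} h.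

Definition connected_graph (G : graph) : Prop :=
  forall i j : G, connect (fun a b : G => (0 < #|arrow a b|)%N) i j.

(* [b1; ...; bl] in [bs] stands for a chain i0 - b1 - ... - bl.  The chains
   meet only in i0, cover all vertices, and apart from loops at i0 the graph
   has exactly one edge between consecutive vertices of a chain and no other
   edge. *)
Definition branches_and_loops (G : graph) (i0 : G) : Prop :=
  exists bs : seq (seq G),
    perm_eq (i0 :: flatten bs) (enum G) /\
    forall i j : G, ~~ ((i == i0) && (j == i0)) ->
      #|arrow i j| =
        has (fun b => infix [:: i; j] (i0 :: b) || infix [:: j; i] (i0 :: b))
            bs.

Definition arrow_set (G : graph) := forall i j : G, {set arrow i j}.

(* [h] lies in the reversed set of Om iff [rev h] lies in Om. *)
Definition is_orientation (G : graph) (Om : arrow_set G) : Prop :=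
  (forall (i j : G) (h : arrow i j), ~~ ((h \in Om i j) && (rev h \in Om j i)))
  /\ (forall (i j : G) (h : arrow i j), (h \in Om i j) || (rev h \in Om j i)).

Definition omega (F : fieldType) (G : graph) (Om : arrow_set G)
    (i j : G) (h : arrow i j) : F :=
  if h \in Om i j then 1 else -1.

Arguments omega F {G} Om {i j} h.

Definition rep (F : fieldType) (G : graph) (V : G -> vectType F) :=
  forall i j : G, arrow i j -> 'Hom(V i, V j).

Definition moment_map (F : fieldType) (G : graph) (Om : arrow_set G)
    (V : G -> vectType F) (B : rep V) (i : G) : 'End(V i) :=
  \sum_(j : G) \sum_(h : arrow i j)
    omega F Om h *: (B j i (rev h) \o B i j h)%VF.

Inductive walk (G : graph) : G -> G -> Type :=
| walk_nil (i : G) : walk i i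
| walk_cons (i j k : G) : arrow i j -> walk j k -> walk i k.

Fixpoint walk_length (G : graph) (i j : G) (p : walk i j) : nat :=
  match p with
  | walk_nil _ => 0
  | walk_cons _ _ _ _ q => (walk_length q).+1
  end.

(* The walk g_1, ..., g_k is sent to B_{g_k} ... B_{g_1}. *)
Fixpoint walk_op (F : fieldType) (G : graph) (V : G -> vectType F) (B : rep V)
    (i j : G) (p : walk i j) : 'Hom(V i, V j) :=
  match p in walk a b return 'Hom(V a, V b) with
  | walk_nil _ => \1%VF
  | walk_cons _ _ _ h q => (walk_op B q \o B _ _ h)%VF
  end.

Definition nilpotent_rep (F : fieldType) (G : graph) (V : G -> vectType F)
    (B : rep V) : Prop :=
  exists N : nat, forall k : nat, (N < k)%N ->
    forall (i j : G) (p : walk i j), walk_length p = k -> walk_op B p = 0.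

Definition nilpotent_set (F : fieldType) (W : vectType F)
    (S : 'End(W) -> Prop) : Prop :=
  exists N : nat, forall k : nat, (N < k)%N ->
    forall s : seq 'End(W), size s = k -> (forall X, X \in s -> S X) ->
      foldr (fun X Y => (X \o Y)%VF) \1%VF s = 0.

Definition branch_op (F : fieldType) (G : graph) (Om : arrow_set G)
    (V : G -> vectType F) (B : rep V) (i0 j : G) (h : arrow i0 j) :
    'End(V i0) :=
  omega F Om h *: (B j i0 (rev h) \o B i0 j h)%VF.

Definition center_ops (F : fieldType) (G : graph) (Om : arrow_set G)
    (V : G -> vectType F) (B : rep V) (i0 : G) (X : 'End(V i0)) : Prop :=
  (exists (j : G) (h : arrow i0 j), j != i0 /\ X = branch_op Om B h) \/
  (exists h : arrow i0 i0,
     (h \in Om i0 i0 \/ rev h \in Om i0 i0) /\ X = B i0 i0 h).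

(* Main.v *)
Require Import Defs.
From HB Require Import structures.
From mathcomp Require Import all_boot all_order all_algebra.
From mathcomp Require Import zify.
(* So that [rev] is the reversal of arrows and not that of sequences. *)
Import Defs.

(** The implication from representations to operators is immediate: a product
    of operators attached to [i0] is, up to a scalar, the operator of a closed
    walk at [i0] that is at least as long as the product.

    The converse is a normal form argument.  Orient each branch by the distance
    to [i0], so that a vertex [i] other than [i0] has one parent, at most one
    child, and no other neighbour.  The moment map equation at [i] then says
    that stepping from [i] to its child and back is a scalar multiple of
    stepping from [i] to its parent and back ([child_detour]).  Used repeatedly,
    this moves the first step towards [i0] to the very beginning of a walk, so
    a walk starting at [i] either only moves away from [i0], hence is short, or
    begins, up to a scalar, with the step to the parent of [i]
    ([step_to_parent_first]).

    For a walk starting at [i0] and entering a branch, this turns its first two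
    steps into the operator of that branch; peeling off such operators and the
    loops writes the walk as a product of about half its length of operators
    from the given set, followed by some linear map ([center_walk_factor]).  So
    long walks from [i0] vanish, and by induction on the distance to [i0] so do
    long walks from any vertex.  The signs given by the orientation enter only
    through being nonzero scalars. *)

Set Implicit Arguments.
Unset Strict Implicit.
Unset Printing Implicit Defensive.

Import GRing.Theory.
Local Open Scope ring_scope.

(** * Parents and children along the branches *)

Lemma uniq_mem_flatten (T : eqType) (bs : seq (seq T)) (b : seq T) :
  uniq (flatten bs) -> b \in bs -> uniq b.
Proof.
move=> U /splitPr bbs; move: U; case: bbs => p1 p2.
by rewrite flatten_cat cat_uniq /= cat_uniq => /and3P[_ _ /and3P[]].
Qed.

Lemma nth_find_flatten (T : eqType) (bs : seq (seq T)) (b : seq T) (x : T) :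
  uniq (flatten bs) -> b \in bs -> x \in b ->
  nth [::] bs (find (fun c => x \in c) bs) = b.
Proof.
elim: bs => //= c bs IH; rewrite cat_uniq => /and3P[_ /hasPn dis U].
rewrite inE => /predU1P[-> -> // | bbs xb].
have /dis/negbTE/= -> : x \in flatten bs by apply/flattenP; exists b.
exact: IH.
Qed.

Lemma index_uniq_cat (T : eqType) (s1 s2 : seq T) (x : T) :
  uniq (s1 ++ x :: s2) -> index x (s1 ++ x :: s2) = size s1.
Proof.
rewrite cat_uniq => /and3P[_ /norP[/negbTE xs1 _] _].
by rewrite index_cat xs1 /= eqxx addn0.
Qed.

(** All that is used of the shape of the graph: away from [i0] it is a rooted
    forest of paths hanging from [i0].  At [i0], and for [child] also at the tip
    of a branch, [parent] and [child] take arbitrary values. *)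
Definition branch_forest (G : graph) (i0 : G) (depth : G -> nat)
    (parent child : G -> G) : Prop :=
  [/\ forall i, i != i0 -> depth i = (depth (parent i)).+1,
      forall i, i != i0 -> #|arrow i (parent i)| = 1%N
    & forall i j, arrow i j -> i != i0 ->
        j = parent i \/ [/\ j != i0, j = child i & parent j = i]].

Lemma branches_forest (G : graph) (i0 : G) : branches_and_loops i0 ->
  exists (depth : G -> nat) (parent child : G -> G),
    branch_forest i0 depth parent child.
Proof.
case=> bs [perm_bs card_arrow].
have U : uniq (i0 :: flatten bs) by rewrite (perm_uniq perm_bs) enum_uniq.
have /andP[i0bs Uf] := U.
pose branch i := i0 :: nth [::] bs (find (fun c => i \in c) bs).
pose depth i := index i (branch i).
pose parent i := nth i0 (branch i) (depth i).-1.
pose child i := nth i0 (branch i) (depth i).+1.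
have branchE b i : b \in bs -> i \in b -> branch i = i0 :: b.
  by move=> bbs ib; rewrite /branch (nth_find_flatten Uf bbs ib).
have edgeP b i j : b \in bs -> infix [:: i; j] (i0 :: b) ->
    [/\ j != i0, depth j = (depth i).+1, parent j = i & i != i0 -> child i = j].
  move=> bbs /infixP[s1 [s2 def_b]].
  have i0b : i0 \notin b.
    by apply: contra i0bs => i0b; apply/flattenP; exists b.
  have Ub : uniq (i0 :: b) by rewrite /= i0b (uniq_mem_flatten Uf bbs).
  have jb : j \in b.
    by case: s1 def_b => [|x s1] [_ ->]; rewrite ?mem_cat !inE eqxx ?orbT.
  have def_b' : i0 :: b = (s1 ++ [:: i]) ++ j :: s2 by rewrite -catA.
  have ib : i != i0 -> i \in b.
    have : i \in i0 :: b by rewrite def_b mem_cat inE eqxx orbT.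
    by rewrite inE => /predU1P[->|//]; rewrite eqxx.
  have depth_i : depth i = size s1.
    have <- : index i (i0 :: b) = size s1.
      by rewrite def_b index_uniq_cat // -[s1 ++ _]def_b.
    have [-> | ii0] := eqVneq i i0; first by rewrite /depth /= eqxx.
    by rewrite /depth (branchE b) // ib.
  have depth_j : depth j = (size s1).+1.
    rewrite /depth (branchE b) // def_b' index_uniq_cat -?def_b' //.
    by rewrite size_cat addn1.
  split.
  - by apply: contraNneq i0b => <-.
  - by rewrite depth_i depth_j.
  - by rewrite /parent depth_j (branchE b) // def_b nth_cat ltnn subnn.
  - move=> /ib ib'; rewrite /child depth_i (branchE b) // def_b nth_cat.
    by rewrite ltnNge leqnSn subSnn.
have parent_edge i : i != i0 ->
    exists2 b, b \in bs & infix [:: parent i; i] (i0 :: b).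
  move=> ii0.
  have [b bbs ib] : exists2 b, b \in bs & i \in b.
    apply/flattenP; have : i \in i0 :: flatten bs.
      by rewrite (perm_mem perm_bs) mem_enum.
    by rewrite inE (negbTE ii0).
  have [k ki] : exists k, infix [:: k; i] (i0 :: b).
    case/splitPr: ib => p1 p2; exists (last i0 p1).
    apply/infixP; exists (belast i0 p1), p2.
    by rewrite -cat_cons lastI cat_rcons.
  by have [_ _ -> _] := edgeP _ _ _ bbs ki; exists b.
exists depth, parent, child; split.
- by move=> i /parent_edge[b bbs /(edgeP _ _ _ bbs)[]].
- move=> i ii0; rewrite card_arrow ?(negbTE ii0) //.
  have [b bbs bi] := parent_edge i ii0.
  by rewrite (introT hasP) //; exists b; rewrite // bi orbT.
- move=> i j h ii0.
  have : (0 < #|arrow i j|)%N by apply/card_gt0P; exists h.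
  rewrite card_arrow ?(negbTE ii0) // lt0b => /hasP[b bbs].
  case/orP => /(edgeP _ _ _ bbs)[ji0 _ par_j ch_i]; last by left.
  by right; rewrite ch_i.
Qed.

Lemma arrow_from_parent_unique (G : graph) (i0 : G) (depth : G -> nat)
    (parent child : G -> G) (i : G) (h h' : arrow (parent i) i) :
  branch_forest i0 depth parent child -> i != i0 -> h = h'.
Proof.
case=> _ card1 _ ii0; rewrite -(revK h) -(revK h'); congr rev.
by have [x all_x] := fintype1 (card1 i ii0); rewrite [LHS]all_x [RHS]all_x.
Qed.

Lemma sum_all_eq (V : nmodType) (T : finType) (f : T -> V) (x : T) :
  (forall y, y = x) -> \sum_(y : T) f y = f x.
Proof.
by move=> all_x; rewrite (bigD1 x) //= big1 ?addr0 // => y; rewrite (all_x y) eqxx.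
Qed.

Lemma omega_neq0 (F : fieldType) (G : graph) (Om : arrow_set G) (i j : G)
  (h : arrow i j) : omega F Om h != 0.
Proof. by rewrite /omega; case: ifP => _; rewrite ?oppr_eq0 oner_neq0. Qed.

(** * Normal form of walks *)

(** The only two neighbours of [i] are its parent and its child [j], so the
    moment map equation at [i] has just these two terms. *)
Lemma child_detour (F : fieldType) (G : graph) (i0 : G) (Om : arrow_set G)
    (V : G -> vectType F) (B : rep V) (depth : G -> nat) (parent child : G -> G)
    (i j : G) (h : arrow i j) (g : arrow i (parent i)) :
  branch_forest i0 depth parent child -> moment_map Om B i = 0 ->
  i != i0 -> j != i0 -> parent j = i ->
  exists c : F, (B j i (rev h) \o B i j h)%VF
                = c *: (B (parent i) i (rev g) \o B i (parent i) g)%VF.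
Proof.
move=> forest + ii0 ji0 par_j; have [depthS card1 nbr] := forest.
have jpi : j != parent i.
  apply/eqP=> def_j; have := depthS i ii0; have := depthS j ji0.
  by rewrite par_j -def_j; lia.
rewrite /moment_map (bigD1 j) //= (bigD1 (parent i)) 1?eq_sym //=.
rewrite [X in _ + (_ + X)]big1 => [|k /andP[kj kpi]]; last first.
  apply: big1 => e _; case: (nbr _ _ e ii0) => [def_k | [_ def_k _]].
    by rewrite def_k eqxx in kpi.
  case: (nbr _ _ h ii0) => [def_j | [_ def_j _]].
    by rewrite def_j eqxx in jpi.
  by rewrite def_k def_j eqxx in kj.
rewrite addr0 (sum_all_eq _ (x := h)); last first.
  by move=> y; subst i; exact: (arrow_from_parent_unique _ _ forest).
rewrite (sum_all_eq _ (x := g)); last first.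
  have [x all_x] := fintype1 (card1 i ii0).
  by move=> y; rewrite [LHS]all_x [RHS]all_x.
move=> /eqP; rewrite addr_eq0 => /eqP eq_h.
exists (- (omega F Om h)^-1 * omega F Om g).
apply: (scalerI (omega_neq0 F Om h)); rewrite eq_h scalerA mulrA.
by rewrite mulrN divff ?omega_neq0 // mulN1r scaleNr.
Qed.

(** Induction on the walk: a first step to a child is followed either by steps
    away from [i0] only or, by induction, by the step back, and then
    [child_detour] replaces this detour by one through the parent. *)
Lemma step_to_parent_first (F : fieldType) (G : graph) (i0 : G)
    (Om : arrow_set G) (V : G -> vectType F) (B : rep V) (depth : G -> nat)
    (parent child : G -> G) (L : nat) :
  branch_forest i0 depth parent child -> (forall i, moment_map Om B i = 0) ->
  (forall i, (depth i <= L)%N) ->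
  forall (i j : G) (p : walk i j), i != i0 ->
  (walk_length p + depth i <= L)%N \/
  exists (g : arrow i (parent i)) (q : walk (parent i) j) (c : F),
    walk_op B p = c *: (walk_op B q \o B i (parent i) g)%VF /\
    walk_length p = (walk_length q).+1.
Proof.
move=> forest hB depth_le i j; elim=> {i j} [i|i k j h q IH] ii0.
  by left; rewrite add0n.
have [depthS card1 nbr] := forest.
case: (nbr _ _ h ii0) => [def_k | [ki0 _ par_k]].
  by subst k; right; exists h, q, 1; rewrite scale1r.
have [q_le | [h' [q' [c [op_q size_q]]]]] := IH ki0.
  by left; move: q_le; rewrite (depthS k) // par_k /= addSnnS.
right; have [g _] := fintype1 (card1 i ii0).
have [c' detour] := child_detour h g forest (hB i) ii0 ki0 par_k.
subst i.
have def_h' : h' = rev h.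
  by rewrite -(revK h') (arrow_from_parent_unique (rev h') h forest).
exists g, (walk_cons (rev g) q'), (c * c'); split; last by rewrite /= size_q.
rewrite /= op_q def_h' -comp_lfunZl -scalerA -!comp_lfunA detour.
by rewrite -comp_lfunZr.
Qed.

Lemma foldr_comp_lfun (F : fieldType) (W : vectType F) (s : seq 'End(W))
    (Z : 'End(W)) :
  foldr (fun X Y => (X \o Y)%VF) Z s
  = (foldr (fun X Y => (X \o Y)%VF) \1%VF s \o Z)%VF.
Proof.
by elim: s => [|X s IH] /=; rewrite ?comp_lfun1l // IH comp_lfunA.
Qed.

Lemma foldr_comp_rcons (F : fieldType) (W : vectType F) (s : seq 'End(W))
    (X : 'End(W)) :
  foldr (fun X Y => (X \o Y)%VF) \1%VF (rcons s X)
  = (foldr (fun X Y => (X \o Y)%VF) \1%VF s \o X)%VF.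
Proof. by rewrite foldr_rcons comp_lfun1r foldr_comp_lfun. Qed.

Lemma walk_first (G : graph) (i j : G) (p : walk i j) :
  walk_length p = 0%N \/
  exists (k : G) (h : arrow i k) (q : walk k j), p = walk_cons h q.
Proof. by case: p => [|i' k j' h q]; [left | right; exists k, h, q]. Qed.

(** A walk from [i0] that does not start with a loop enters a branch; unless it
    is short, [step_to_parent_first] lets it return to [i0] at once, and its
    first two steps form a branch operator. *)
Lemma center_walk_factor (F : fieldType) (G : graph) (i0 : G)
    (Om : arrow_set G) (V : G -> vectType F) (B : rep V) (depth : G -> nat)
    (parent child : G -> G) (L : nat) :
  is_orientation Om ->
  branch_forest i0 depth parent child -> (forall i, moment_map Om B i = 0) ->
  (forall i, (depth i <= L)%N) ->
  forall (j : G) (p : walk i0 j),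
  exists (s : seq 'End(V i0)) (A : 'Hom(V i0, V j)),
  [/\ forall X, X \in s -> center_ops Om B X,
      walk_op B p = (A \o foldr (fun X Y => (X \o Y)%VF) \1%VF s)%VF
    & (walk_length p <= (size s).*2 + L)%N].
Proof.
move=> [_ hOm] forest hB depth_le j p; have [n] := ubnP (walk_length p).
elim: n p => // n IH p; rewrite ltnS => p_le.
have [short | long] := leqP (walk_length p) L.
  by exists [::], (walk_op B p); rewrite /= comp_lfun1r.
have extend (X : 'End(V i0)) (q : walk i0 j) (c : F) :
    (walk_length q < walk_length p)%N -> (walk_length p <= (walk_length q).+2)%N ->
    center_ops Om B X -> walk_op B p = c *: (walk_op B q \o X)%VF ->
    exists (s : seq 'End(V i0)) (A : 'Hom(V i0, V j)),
    [/\ forall X, X \in s -> center_ops Om B X,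
        walk_op B p = (A \o foldr (fun X Y => (X \o Y)%VF) \1%VF s)%VF
      & (walk_length p <= (size s).*2 + L)%N].
  move=> lt_qp le_pq X_ops op_p.
  have [s [A [s_ops op_q q_le]]] := IH q (leq_trans lt_qp p_le).
  exists (rcons s X), (c *: A); split.
  - by move=> Y; rewrite mem_rcons inE => /predU1P[->|/s_ops].
  - by rewrite op_p op_q foldr_comp_rcons -comp_lfunZl comp_lfunA.
  - by rewrite size_rcons; lia.
have [p0 | [k [h [q def_p]]]] := walk_first p; first by rewrite p0 in long.
have [def_k | ki0] := eqVneq k i0.
  subst k; apply: (extend (B i0 i0 h) q 1); rewrite ?def_p //= ?scale1r //.
  by right; exists h; split=> //; apply/orP.
have [depthS _ nbr] := forest.
have par_k : i0 = parent k.
  by case: (nbr _ _ (rev h) ki0) => // -[]; rewrite eqxx.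
have [q_le | [h' [q' [c [op_q size_q]]]]] :=
    step_to_parent_first forest hB depth_le q ki0.
  by move: long; rewrite def_p /=; move: q_le; rewrite depthS //; lia.
subst i0.
have def_h' : h' = rev h.
  by rewrite -(revK h') (arrow_from_parent_unique (rev h') h forest).
apply: (extend (branch_op Om B h) q' (c * (omega F Om h)^-1)).
- by rewrite def_p /= size_q.
- by rewrite def_p /= size_q.
- by left; exists k, h.
- rewrite def_p /= op_q def_h' -comp_lfunZl -comp_lfunA /branch_op.
  by rewrite -comp_lfunZr scalerA mulfVK ?omega_neq0.
Qed.

(** * Comparison of the two nilpotency conditions *)

Lemma center_ops_walk (F : fieldType) (G : graph) (Om : arrow_set G)
    (V : G -> vectType F) (B : rep V) (i0 : G) (s : seq 'End(V i0)) :
  (forall X, X \in s -> center_ops Om B X) ->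
  exists (p : walk i0 i0) (c : F),
    foldr (fun X Y => (X \o Y)%VF) \1%VF s = c *: walk_op B p /\
    (size s <= walk_length p)%N.
Proof.
elim/last_ind: s => [|s X IH] s_ops.
  by exists (walk_nil i0), 1; rewrite /= scale1r.
have [Y Ys|p [c [op_s s_le]]] := IH.
  by apply: s_ops; rewrite mem_rcons inE Ys orbT.
have : center_ops Om B X by apply: s_ops; rewrite mem_rcons mem_head.
rewrite foldr_comp_rcons op_s size_rcons => -[[j [h [_ ->]]] | [h [_ ->]]].
- exists (walk_cons h (walk_cons (rev h) p)), (c * omega F Om h) => /=.
  split; last by lia.
  by rewrite /branch_op -comp_lfunZr -comp_lfunZl scalerA mulrC comp_lfunA.
- exists (walk_cons h p), c; split=> //=.
  by rewrite comp_lfunZl.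
Qed.

Theorem proposition1 (F : fieldType) (G : graph) (i0 : G)
  (hconn : connected_graph G) (hshape : branches_and_loops i0)
  (Om : arrow_set G) (hOm : is_orientation Om)
  (v : G -> nat) (V : G -> vectType F)
  (hV : forall i : G, \dim (fullv : {vspace V i}) = v i)
  (B : rep V) (hB : forall i : G, moment_map Om B i = 0%R) :
  nilpotent_rep B <-> nilpotent_set (center_ops Om B (i0 := i0)).
Proof.
split=> [] [N nilN].
  exists N => k lt_Nk s size_s /center_ops_walk[p [c [-> s_le]]].
  have lt_Np : (N < walk_length p)%N by rewrite -size_s in lt_Nk; lia.
  by rewrite (nilN _ lt_Np _ _ p erefl) scaler0.
have [depth [parent [child forest]]] := branches_forest hshape.
have [L depth_le] : exists L, forall i, (depth i <= L)%N.
  by exists (\max_i depth i) => i; apply: leq_bigmax.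
have nil_center (j : G) (p : walk i0 j) :
    (N.*2 + L < walk_length p)%N -> walk_op B p = 0.
  have [s [A [s_ops -> p_le]]] := center_walk_factor hOm forest hB depth_le p.
  move=> lt_p; rewrite (nilN (size s)) ?comp_lfun0r //; lia.
(* Replacing a walk from [i] by one from its parent costs one unit of length,
   so the bound grows with the depth. *)
have nil_from d (i j : G) (p : walk i j) :
    (depth i <= d)%N -> (N.*2 + L + d < walk_length p)%N -> walk_op B p = 0.
  elim: d i p => [|d IH] i p depth_i lt_p; have [i_i0 | ii0] := eqVneq i i0.
  - by subst i; apply: nil_center; lia.
  - by have [depthS _ _] := forest; rewrite depthS in depth_i.
  - by subst i; apply: nil_center; lia.
  - have [p_le | [g [q [c [-> size_p]]]]] :=
        step_to_parent_first forest hB depth_le p ii0; first by lia.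
    have [depthS _ _] := forest; rewrite depthS // in depth_i.
    by rewrite (IH _ q) ?comp_lfun0l ?scaler0 //; lia.
exists (N.*2 + L + L)%N => k lt_k i j p size_p.
by apply: (nil_from L i j p); rewrite ?size_p.
Qed.
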